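(* Let $n\geq 3$. Then $\mathcal{IP}_n=\langle\mathcal{S}_n,\xi_{1,2,3}\rangle$. Moreover, for $u\in\mathcal{IP}_n$, $\mathcal{IP}_n=\langle\mathcal{S}_n,u\rangle$ if and only if $u\in\mathcal{S}_n\xi_{1,2,3}\mathcal{S}_n$.
   Context: Let $X$ be an arbitrary set and let $X'=\{x':x\in X\}$ be a disjoint copy of $X$, with $x\mapsto x'$ a fixed bijection $X\to X'$; the inverse bijection is also denoted by $'$. Let $\mathcal{CS}_X$ be the set of all partitions of $X\cup X'$ into nonempty blocks. For $a\in\mathcal{CS}_X$ write $x\equiv_a y$ if $x,y\in X\cup X'$ lie in the same block of $a$. The product $ab$ of $a,b\in\mathcal{CS}_X$ is the partition corresponding to the equivalence relation $\equiv$ on $X\cup X'$ defined, for $x,y\in X$, by: (i) $x\equiv y$ iff $x\equiv_a y$ or there are $s\ge 1$ and $c_1,\dots,c_{2s}\in X$ with $x\equiv_a c_1'$, $c_1\equiv_b c_2$, $c_2'\equiv_a c_3'$, $\dots$, $c_{2s-1}\equiv_b c_{2s}$, $c_{2s}'\equiv_a y$; (ii) $x'\equiv y'$ iff $x'\equiv_b y'$ or there are $s\ge 1$ and $c_1,\dots,c_{2s}\in X$ with $x'\equiv_b c_1$, $c_1'\equiv_a c_2'$, $c_2\equiv_b c_3$, $\dots$, $c_{2s-1}'\equiv_a c_{2s}'$, $c_{2s}\equiv_b y'$; (iii) $x\equiv y'$ iff $y'\equiv x$ iff there are $s\ge 1$ and $c_1,\dots,c_{2s-1}\in X$ with $x\equiv_a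 c_1'$, $c_1\equiv_b c_2$, $c_2'\equiv_a c_3'$, $\dots$, $c_{2s-2}'\equiv_a c_{2s-1}'$, $c_{2s-1}\equiv_b y'$. With this product $\mathcal{CS}_X$ is a semigroup, and $\mathcal{IP}_X$ is the subsemigroup of all $a\in\mathcal{CS}_X$ each of whose blocks meets both $X$ and $X'$. For $X=\{1,\dots,n\}$ write $\mathcal{IP}_n$. The symmetric group $\mathcal{S}_n$ (permutations multiplied left to right, $(gh)(x)=h(g(x))$) is identified with a subgroup of $\mathcal{IP}_n$ via $g\mapsto\{\{x,g(x)'\}:x\in\{1,\dots,n\}\}$. For $n\ge3$, $\xi_{1,2,3}\in\mathcal{IP}_n$ is the partition with blocks $\{1,2,1'\}$, $\{3,2',3'\}$ and $\{t,t'\}$ for $t\in\{1,\dots,n\}\setminus\{1,2,3\}$. $\langle\mathcal{S}_n,u\rangle$ denotes the subsemigroup generated by $\mathcal{S}_n\cup\{u\}$. *)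

(* Defs.v *)
From HB Require Import structures.
From mathcomp Require Import all_boot all_fingroup.
From mathcomp Require Import boolp zify.

Set Implicit Arguments.
Unset Strict Implicit.
Unset Printing Implicit Defensive.

(* The disjoint union of X and X' is the sum type X + X: the element x of X is
   inl x and its copy x' is inr x. *)
Record CS (X : finType) := MkCS {
  blocks :> {set {set X + X}};
  blocksP : partition blocks [set: X + X]
}.

HB.instance Definition _ (X : finType) := [isSub for @blocks X].
HB.instance Definition _ (X : finType) := [Finite of CS X by <:].

Definition same_block (X : finType) (a : CS X) (u v : X + X) : bool :=
  pblock a u == pblock a v.

Section Product.
Variables (X : finType) (a b : CS X).

(* Only the values c 1, ..., c s.*2 matter in chain_top and chain_bot, and only
   c 1, ..., c s.*2.-1 in chain_across. *)
Definition chain_top (x y : X) : Prop :=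
  exists s : nat, exists c : nat -> X,
    [/\ 1 <= s,
        same_block a (inl x) (inr (c 1)),
        forall i, 1 <= i <= s ->
          same_block b (inl (c i.*2.-1)) (inl (c i.*2)),
        forall i, 1 <= i < s ->
          same_block a (inr (c i.*2)) (inr (c i.*2.+1))
      & same_block a (inr (c s.*2)) (inl y)].

Definition chain_bot (x y : X) : Prop :=
  exists s : nat, exists c : nat -> X,
    [/\ 1 <= s,
        same_block b (inr x) (inl (c 1)),
        forall i, 1 <= i <= s ->
          same_block a (inr (c i.*2.-1)) (inr (c i.*2)),
        forall i, 1 <= i < s ->
          same_block b (inl (c i.*2)) (inl (c i.*2.+1))
      & same_block b (inl (c s.*2)) (inr y)].

Definition chain_across (x y : X) : Prop :=
  exists s : nat, exists c : nat -> X,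
    [/\ 1 <= s,
        same_block a (inl x) (inr (c 1)),
        forall i, 1 <= i < s ->
          same_block b (inl (c i.*2.-1)) (inl (c i.*2)),
        forall i, 1 <= i < s ->
          same_block a (inr (c i.*2)) (inr (c i.*2.+1))
      & same_block b (inl (c s.*2.-1)) (inr y)].

Definition mul_equiv (u v : X + X) : Prop :=
  match u, v with
  | inl x, inl y => same_block a (inl x) (inl y) \/ chain_top x y
  | inr x, inr y => same_block b (inr x) (inr y) \/ chain_bot x y
  | inl x, inr y => chain_across x y
  | inr y, inl x => chain_across x y
  end.

Definition mul_blocks : {set {set X + X}} :=
  equivalence_partition (fun u v => `[< mul_equiv u v >]) [set: X + X].

End Product.

Lemma alternating_connect (X : finType) (p q : rel X) s (c : nat -> X) :
  (forall i, 1 <= i <= s -> p (c i.*2.-1) (c i.*2)) ->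
  (forall i, 1 <= i < s -> q (c i.*2) (c i.*2.+1)) ->
  forall i, 1 <= i <= s ->
  connect (fun c d => q c d || p c d) (c 1) (c i.*2).
Proof.
move=> hp hq; elim=> [|[_|i IH]] // hi.
  by apply/connect1; rewrite (hp 1) ?orbT.
have hi1 : 1 <= i.+1 < s by lia.
apply: connect_trans (IH _) _; first by lia.
apply: (@connect_trans _ _ (c i.+1.*2.+1)); apply/connect1; first by rewrite hq.
by rewrite (hp i.+2) ?orbT.
Qed.

Lemma connect_alternating (X : finType) (p q : rel X) x y :
  reflexive p -> reflexive q -> transitive p ->
  connect (fun c d => q c d || p c d) x y ->
  exists s : nat, exists c : nat -> X,
    [/\ 1 <= s, c 1 = x, c s.*2 = y,
        forall i, 1 <= i <= s -> p (c i.*2.-1) (c i.*2)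
      & forall i, 1 <= i < s -> q (c i.*2) (c i.*2.+1)].
Proof.
move=> pxx qxx ptr /connectP[t + ->]; elim/last_ind: t => [_|t z IH].
  by exists 1, (fun=> x); split => // [i|i]; case: i.
rewrite rcons_path last_rcons => /andP[/IH[s [c [s1 c1 cs hp hq]]] step].
case/orP: step => step.
  exists s.+1, (fun i => if i <= s.*2 then c i else z); split => //.
  - by rewrite ifT //; lia.
  - by rewrite ifF //; lia.
  - move=> i hi; case: (leqP i s) => his.
      by rewrite !ifT; [apply: hp|..]; lia.
    by rewrite !ifF //; lia.
  - move=> i hi; case: (ltnP i s) => his.
      by rewrite !ifT; [apply: hq|..]; lia.
    have -> : i = s by lia.
    by rewrite leqnn ltnn cs.
exists s, (fun i => if i == s.*2 then z else c i); split => //.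
- by rewrite ifF //; lia.
- by rewrite eqxx.
- move=> i hi; rewrite ifF; last by lia.
  case: eqP => his; last by apply: hp.
  by apply: ptr (hp i hi) _; rewrite his cs.
- move=> i hi; rewrite !ifF; try lia.
  exact: hq.
Qed.

Section ProductIsPartition.
Variables (X : finType) (a b : CS X).
Implicit Types (u v w : X + X) (x y c d : X).

Lemma same_block_xx (e : CS X) u : same_block e u u.
Proof. exact: eqxx. Qed.

Lemma same_block_sym (e : CS X) u v : same_block e u v = same_block e v u.
Proof. exact: eq_sym. Qed.

Lemma same_block_trans (e : CS X) : transitive (same_block e).
Proof. by move=> v u w /eqP uv /eqP vw; apply/eqP; rewrite uv. Qed.

Definition mid_step : rel X := fun c d =>
  same_block a (inr c) (inr d) || same_block b (inl c) (inl d).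

Definition attached u c : bool :=
  match u with
  | inl x => same_block a (inl x) (inr c)
  | inr y => same_block b (inl c) (inr y)
  end.

Definition direct u v : bool :=
  match u, v with
  | inl x, inl y => same_block a u v
  | inr x, inr y => same_block b u v
  | _, _ => false
  end.

Lemma mid_connect_sym : connect_sym mid_step.
Proof.
apply: sym_connect_sym => c d.
by rewrite /mid_step (same_block_sym a) (same_block_sym b).
Qed.

Lemma chain_topP x y :
  chain_top a b x y <->
  exists c d, [/\ attached (inl x) c, connect mid_step c d & attached (inl y) d].
Proof.
split=> [[s [c [s1 xc hb ha cy]]]|[c [d [xc cd yd]]]].
  exists (c 1), (c s.*2); split => //; last by rewrite /= same_block_sym.
  by apply: (alternating_connect (p := fun c d => same_block b (inl c) (inl d))
    hb ha); rewrite s1 leqnn.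
have [|||s [f [s1 f1 fs hb ha]]] := connect_alternating _ _ _ cd.
- by move=> z; apply: same_block_xx.
- by move=> z; apply: same_block_xx.
- by move=> z1 z2 z3; apply: same_block_trans.
by exists s, f; rewrite f1 fs; split=> //; rewrite same_block_sym.
Qed.

Lemma chain_botP x y :
  chain_bot a b x y <->
  exists c d, [/\ attached (inr x) c, connect mid_step c d & attached (inr y) d].
Proof.
have E : mid_step =2
  (fun c d => same_block b (inl c) (inl d) || same_block a (inr c) (inr d)).
  by move=> c d; rewrite /mid_step orbC.
split=> [[s [c [s1 xc ha hb cy]]]|[c [d [xc cd yd]]]].
  exists (c 1), (c s.*2); split => //; first by rewrite /= same_block_sym.
  rewrite (eq_connect E).
  by apply: (alternating_connect (p := fun c d => same_block a (inr c) (inr d))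
    ha hb); rewrite s1 leqnn.
rewrite (eq_connect E) in cd.
have [|||s [f [s1 f1 fs ha hb]]] := connect_alternating _ _ _ cd.
- by move=> z; apply: same_block_xx.
- by move=> z; apply: same_block_xx.
- by move=> z1 z2 z3; apply: same_block_trans.
by exists s, f; rewrite f1 fs; split=> //; rewrite same_block_sym.
Qed.

Lemma chain_acrossP x y :
  chain_across a b x y <->
  exists c d, [/\ attached (inl x) c, connect mid_step c d & attached (inr y) d].
Proof.
split=> [[s [c [s1 xc hb ha cy]]]|[c [d [xc cd yd]]]].
  pose f i := if i == s.*2 then c s.*2.-1 else c i.
  exists (f 1), (f s.*2); rewrite {1 4}/f eqxx ifF; last by lia.
  split => //; apply: (@alternating_connect _
    (fun c d => same_block b (inl c) (inl d))
    (fun c d => same_block a (inr c) (inr d)) s f _ _ s) => [i hi|i hi|].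
  - rewrite /f ifF; last by lia.
    case: eqP => his; first by rewrite his; apply: same_block_xx.
    by apply: hb; lia.
  - by rewrite /f !ifF; [apply: ha|lia|lia].
  - by rewrite s1 leqnn.
have [|||s [f [s1 f1 fs hb ha]]] := connect_alternating _ _ _ cd.
- by move=> z; apply: same_block_xx.
- by move=> z; apply: same_block_xx.
- by move=> z1 z2 z3; apply: same_block_trans.
exists s, f; rewrite f1; split => //; first by move=> i hi; apply: hb; lia.
by apply: same_block_trans yd; rewrite -fs; apply: hb; rewrite s1 leqnn.
Qed.

Lemma mul_equivP u v :
  mul_equiv a b u v <->
  direct u v \/
  exists c d, [/\ attached u c, connect mid_step c d & attached v d].
Proof.
case: u v => [x|x] [y|y] /=.
- by split=> -[|/chain_topP]; auto.
- by split=> [/chain_acrossP|[//|/chain_acrossP]]; auto.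
- split=> [/chain_acrossP[c [d [yc cd xd]]]|[//|[c [d [xc cd yd]]]]].
    by right; exists d, c; rewrite mid_connect_sym.
  by apply/chain_acrossP; exists d, c; rewrite mid_connect_sym.
- by split=> -[|/chain_botP]; auto.
Qed.

Lemma direct_attached u v c : direct u v -> attached v c -> attached u c.
Proof.
case: u v => [x|x] [y|y] //= uv vc; first exact: same_block_trans vc.
by apply: same_block_trans vc _; rewrite same_block_sym.
Qed.

Lemma attached_mid u c d : attached u c -> attached u d -> mid_step c d.
Proof.
case: u => x /= uc ud; apply/orP; [left|right].
  by apply: same_block_trans ud; rewrite same_block_sym.
by apply: same_block_trans uc _; rewrite same_block_sym.
Qed.

Lemma direct_sym u v : direct u v = direct v u.
Proof. by case: u v => [x|x] [y|y] //=; apply: same_block_sym. Qed.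

Lemma mul_equiv_refl u : mul_equiv a b u u.
Proof. by apply/mul_equivP; left; case: u => x /=; apply: same_block_xx. Qed.

Lemma mul_equiv_sym u v : mul_equiv a b u v -> mul_equiv a b v u.
Proof.
move=> /mul_equivP uv; apply/mul_equivP; rewrite direct_sym.
case: uv => [|[c [d [uc cd vd]]]]; first by left.
by right; exists d, c; rewrite mid_connect_sym.
Qed.

Lemma mul_equiv_trans u v w :
  mul_equiv a b u v -> mul_equiv a b v w -> mul_equiv a b u w.
Proof.
move=> /mul_equivP[uv|[c [d [uc cd vd]]]] /mul_equivP[vw|[c' [d' [vc' cd' wd']]]];
  apply/mul_equivP.
- left; case: u v w uv vw => [x|x] [y|y] [z|z] //=; exact: same_block_trans.
- by right; exists c', d'; split=> //; apply: direct_attached vc'.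
- right; exists c, d; split=> //; apply: direct_attached vd.
  by rewrite direct_sym.
- right; exists c, d'; split=> //; apply: connect_trans cd _.
  exact: connect_trans (connect1 (attached_mid vd vc')) cd'.
Qed.

Lemma mul_blocks_partition : partition (mul_blocks a b) [set: X + X].
Proof.
apply: equivalence_partitionP => u v w _ _ _; split=> [|/asboolP uv].
  exact/asboolP/mul_equiv_refl.
apply: asbool_equiv_eq; split; last exact: mul_equiv_trans.
exact/mul_equiv_trans/mul_equiv_sym.
Qed.

End ProductIsPartition.

Definition mulCS (X : finType) (a b : CS X) : CS X :=
  MkCS (mul_blocks_partition a b).

HB.instance Definition _ (X : finType) := hasMul.Build (CS X) (@mulCS X).

Local Open Scope group_scope.

Definition IP (X : finType) : {set CS X} :=
  [set a : CS X | [forall B in blocks a,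
     [exists x : X, inl x \in B] && [exists x : X, inr x \in B]]].

Definition gen_subsemigroup (X : finType) (A : {set CS X}) : {set CS X} :=
  \bigcap_(S : {set CS X} |
     (A \subset S) && [forall a in S, forall b in S, a * b \in S]) S.

Lemma fibre_partition (T I : finType) (r : T -> I) (A : {pred I}) :
  (forall t, r t \in A) -> (forall i, i \in A -> exists t, r t = i) ->
  partition [set [set t | r t == i] | i in A] [set: T].
Proof.
move=> rA rsurj.
suff -> : [set [set t | r t == i] | i in A] = preim_partition r [set: T].
  exact: preim_partitionP.
apply/setP=> B; apply/imsetP/imsetP => [[i iA ->]|[t _ ->]].
  have [t <-] := rsurj i iA; exists t => //.
  by apply/setP=> t'; rewrite !inE eq_sym.
by exists (r t) => //; apply/setP=> t'; rewrite !inE eq_sym.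
Qed.

Definition perm_blocks (X : finType) (g : {perm X}) : {set {set X + X}} :=
  [set [set inl x; inr (g x)] | x : X].

Lemma perm_blocks_partition (X : finType) (g : {perm X}) :
  partition (perm_blocks g) [set: X + X].
Proof.
pose r (u : X + X) : X := match u with inl x => x | inr y => g^-1 y end.
have -> : perm_blocks g = [set [set t | r t == i] | i in X].
  apply: eq_imset => x; apply/setP=> -[y|y]; rewrite !inE /= ?orbF //.
  by rewrite -(inj_eq (@perm_inj _ g)) permKV.
by apply: fibre_partition => [//|x _]; exists (inl x).
Qed.

Definition perm_CS (X : finType) (g : {perm X}) : CS X :=
  MkCS (perm_blocks_partition g).

Definition symCS (n : nat) : {set CS 'I_n} := [set perm_CS g | g : 'S_n].

Definition xi_blocks (X : finType) (x1 x2 x3 : X) : {set {set X + X}} :=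
  [set inl x1; inl x2; inr x1] |: ([set inl x3; inr x2; inr x3] |:
    [set [set inl t; inr t] | t in ~: [set x1; x2; x3]]).

Lemma xi_blocks_partition (X : finType) (x1 x2 x3 : X) :
  uniq [:: x1; x2; x3] -> partition (xi_blocks x1 x2 x3) [set: X + X].
Proof.
rewrite /= !inE negb_or andbT => /andP[/andP[n12 n13] n23].
pose r (u : X + X) : X :=
  match u with
  | inl x => if x == x2 then x1 else x
  | inr x => if x == x2 then x3 else x
  end.
have E : ((forall x y, (inl x == inl y :> X + X) = (x == y)) *
          (forall x y, (inr x == inr y :> X + X) = (x == y)) *
          (forall x y, (inl x == inr y :> X + X) = false) *
          (forall x y, (inr x == inl y :> X + X) = false))%type by [].
have neq : ((x1 == x2 = false) * (x2 == x1 = false) * (x1 == x3 = false) *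
            (x3 == x1 = false) * (x2 == x3 = false) * (x3 == x2 = false))%type.
  by rewrite !(eq_sym x3) (eq_sym x2 x1) (negPf n12) (negPf n13) (negPf n23).
have -> : xi_blocks x1 x2 x3 = [set [set t | r t == i] | i in ~: [set x2]].
  have -> : ~: [set x2] = x1 |: (x3 |: ~: [set x1; x2; x3]).
    apply/setP=> x; rewrite !inE; case: (eqVneq x x1) => [->|_] /=; first by rewrite n12.
    by case: (eqVneq x x3) => [->|_] /=; [rewrite eq_sym n23 | rewrite orbF].
  rewrite !imsetU1 /xi_blocks; congr (_ |: (_ |: _)).
  - apply/setP=> u; rewrite !inE; case: u => y; rewrite ?E /r;
      by case: (eqVneq y x2) => [->|_]; rewrite ?eqxx ?neq ?orbT ?orbF.
  - apply/setP=> u; rewrite !inE; case: u => y; rewrite ?E /r;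
      by case: (eqVneq y x2) => [->|_]; rewrite ?eqxx ?neq ?orbT ?orbF.
  - apply: eq_in_imset => t; rewrite !inE !negb_or => /andP[/andP[t1 t2] t3].
    apply/setP=> u; rewrite !inE; case: u => y; rewrite ?E /r;
      case: (eqVneq y x2) => [->|_];
      by rewrite ?orbF // eq_sym (negPf t2) eq_sym ?(negPf t1) ?(negPf t3).
apply: fibre_partition => [[x|x]|i].
- by rewrite !inE /r; case: (eqVneq x x2) => [_|//]; rewrite neq.
- by rewrite !inE /r; case: (eqVneq x x2) => [_|//]; rewrite neq.
- by rewrite !inE => /negPf ni; exists (inl i); rewrite /r ni.
Qed.

(* The points 1, 2, 3 of {1, ..., n} are the ordinals 0, 1, 2 of 'I_n. *)
Definition xi123 (n : nat) (hn : 3 <= n) : CS 'I_n :=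
  @MkCS 'I_n _
    (@xi_blocks_partition 'I_n
       (Ordinal (ltnW (ltnW hn))) (Ordinal (ltnW hn)) (Ordinal hn) isT).

(* Main.v *)
(* An element of IP_X is given by two labellings f, g : X -> X with the same
   image: a block consists of the points of X and of X' carrying one label, and
   in a product the labels are glued along the middle copy of X.

   Generation: if the label t0 is not used, neither f nor g is injective, so
   there are p with f p shared, and y2 <> z with g y2 = g z.  Relabelling p and
   y2 by t0 gives an element with one more block, and the original element is
   recovered by multiplying on the right by the element with blocks
   {y1, y2, y1'}, {z, y2', z'} (or {y1, y2, y1', y2'} if z = y1), where
   g y1 = f p.  Such elements are conjugates of xi, or products of two of them.

   Converse: the elements all of whose blocks meet X and X' in equally many
   points, together with those of rank at most n - 2, form a subsemigroup
   containing S_n but not xi.  An element outside it has n - 1 blocks and joins a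
   pair of points of X to one of X', and one of X to a pair of X', so it lies in
   S_n xi S_n. *)
Require Import Defs.
From mathcomp Require Import all_boot all_fingroup.
From mathcomp Require Import boolp zify.

Set Implicit Arguments.
Unset Strict Implicit.
Unset Printing Implicit Defensive.

Local Open Scope group_scope.

(** * Partitions given by labellings of [X] and [X'], and their products *)

Section Labels.
Variable X : finType.
Implicit Types (a b : CS X) (u v : X + X).

Lemma CS_ext a b : same_block a =2 same_block b -> a = b.
Proof.
move=> ab; apply: val_inj => /=.
rewrite -(preim_partition_pblock (blocksP a)) -(preim_partition_pblock (blocksP b)).
apply: eq_imset => u; apply/setP=> v; rewrite !inE /=.
exact: ab.
Qed.

Lemma same_block_pblock a u v : same_block a u v = (v \in pblock a u).
Proof.
have /and3P[/eqP ca ta _] := blocksP a.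
by rewrite /same_block eq_pblock // ca inE.
Qed.

Lemma same_block_mul a b u v : same_block (a * b) u v <-> mul_equiv a b u v.
Proof.
rewrite same_block_pblock /= /mul_blocks pblock_equivalence_partition ?inE //.
  by split=> /asboolP.
move=> u1 v1 w1 _ _ _; split=> [|/asboolP uv]; first exact/asboolP/mul_equiv_refl.
apply: asbool_equiv_eq; split; last exact: mul_equiv_trans.
exact/mul_equiv_trans/mul_equiv_sym.
Qed.

Lemma IP_P a :
  reflect (forall u, (exists x, same_block a u (inl x)) /\
                     (exists y, same_block a u (inr y)))
          (a \in IP X).
Proof.
have /and3P[/eqP ca ta n0] := blocksP a.
rewrite inE; apply: (iffP forall_inP) => [h u|h B Ba].
  have Ba : pblock a u \in blocks a by rewrite pblock_mem // ca inE.
  have /andP[/existsP[x xB] /existsP[y yB]] := h _ Ba.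
  by split; [exists x | exists y]; rewrite same_block_pblock.
have /set0Pn[u uB] : B != set0 by apply: contraNneq n0 => <-.
have [[x xu] [y yu]] := h u; move: xu yu.
rewrite !same_block_pblock (def_pblock ta Ba uB) => xB yB.
by apply/andP; split; apply/existsP; [exists x | exists y].
Qed.

Section Label.
Variables (T : eqType) (f g : X -> T).

Definition label u := match u with inl x => f x | inr y => g y end.

Definition labelCS : CS X := MkCS (preim_partitionP label [set: X + X]).

Lemma same_block_label u v : same_block labelCS u v = (label u == label v).
Proof.
rewrite same_block_pblock /= /preim_partition pblock_equivalence_partition ?inE //.
by move=> ? ? ? _ _ _; split=> // /eqP->.
Qed.

Lemma labelCS_IP : codom f =i codom g -> labelCS \in IP X.
Proof.
move=> fg; apply/IP_P => u.
have fu : label u \in codom f by case: u => x; rewrite /= ?codom_f // fg codom_f.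
have gu : label u \in codom g by rewrite -fg.
case/codomP: fu => x ux; case/codomP: gu => y uy.
by split; [exists x | exists y]; rewrite same_block_label /= -?ux -?uy eqxx.
Qed.

End Label.

Lemma labelCS_ext (T T' : eqType) (f g : X -> T) (f' g' : X -> T') :
  (forall u v, (label f g u == label f g v) = (label f' g' u == label f' g' v)) ->
  labelCS f g = labelCS f' g'.
Proof. by move=> h; apply: CS_ext => u v; rewrite !same_block_label. Qed.

Lemma eq_labelCS (T : eqType) (f g f' g' : X -> T) :
  f =1 f' -> g =1 g' -> labelCS f g = labelCS f' g'.
Proof.
move=> ff gg; have E : label f g =1 label f' g' by case=> x /=.
by apply: labelCS_ext => u v; rewrite !E.
Qed.

Lemma labelCS_inj (T T' : eqType) (r : T -> T') (f g : X -> T) :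
  injective r -> labelCS (r \o f) (r \o g) = labelCS f g.
Proof.
move=> rI; have E : label (r \o f) (r \o g) =1 r \o label f g by case=> x /=.
by apply: labelCS_ext => u v; rewrite !E /= (inj_eq rI).
Qed.

(** Each block is labelled by a chosen point of its part in [X]; the two images agree because every
    block also meets [X']. *)
Lemma IP_label a : a \in IP X ->
  exists f g : X -> X, codom f =i codom g /\ a = labelCS f g.
Proof.
move=> /IP_P aIP.
(* The choice by [pick] depends on the block of [u] alone; the default, which depends on [u] itself,
   is never reached. *)
pose rep u := odflt (xchoose (aIP u).1) [pick x | same_block a u (inl x)].
have repP u : same_block a u (inl (rep u)).
  rewrite /rep; case: pickP => [x //|/(_ (xchoose (aIP u).1))].
  by rewrite (xchooseP (aIP u).1).
have repE u v : same_block a u v = (rep u == rep v).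
  apply/idP/eqP=> [uv|E].
    rewrite /rep (eq_pick (Q := fun x => same_block a v (inl x))).
      case: pickP => // /(_ (rep v)); by rewrite repP.
    by move=> x; rewrite /same_block (eqP uv).
  apply: same_block_trans (repP u) _; rewrite E same_block_sym; exact: repP.
exists (rep \o inl), (rep \o inr); split.
  move=> t; apply/codomP/codomP => -[x ->] /=.
    have [_ [y xy]] := aIP (inl x).
    by exists y; apply/eqP; rewrite -repE.
  have [[y xy] _] := aIP (inr x).
  by exists y; apply/eqP; rewrite -repE.
apply: CS_ext => u v; rewrite same_block_label repE.
by case: u v => [x|x] [y|y].
Qed.

(** Compatibility of [phi] and [psi] keeps the glued label constant along chains through the middle
    copy; the last hypothesis says that the gluing identifies nothing more. Equality of images
    attaches every point to the middle. *)
Lemma mul_labelCS (T1 T2 T : eqType) (f g : X -> T1) (p q : X -> T2)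
    (phi : T1 -> T) (psi : T2 -> T) :
  codom f =i codom g -> codom p =i codom q -> phi \o g =1 psi \o p ->
  (forall c d, phi (g c) = phi (g d) ->
     connect (mid_step (labelCS f g) (labelCS p q)) c d) ->
  labelCS f g * labelCS p q = labelCS (phi \o f) (psi \o q).
Proof.
move=> fg pq m conn; set a := labelCS f g; set b := labelCS p q.
pose L := label (phi \o f) (psi \o q).
have attL u c : attached a b u c -> L u = phi (g c).
  case: u => x /=; rewrite same_block_label /= => /eqP; first by move->.
  by rewrite [phi _]m /= => ->.
have att u : exists c, attached a b u c.
  case: u => x; [have /codomP[c xc] : f x \in codom g by rewrite -fg codom_f
               | have /codomP[c xc] : q x \in codom p by rewrite pq codom_f];
  by exists c; rewrite /= same_block_label /= xc.
have connL c d : connect (mid_step a b) c d -> phi (g c) = phi (g d).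
  case/connectP=> s + ->; elim: s c => //= e s IH c /andP[ce es].
  rewrite -(IH e es); case/orP: ce; rewrite same_block_label /= => /eqP; first by move->.
  by rewrite ![phi _]m /= => ->.
apply: CS_ext => u v; rewrite same_block_label -/L.
apply/idP/eqP => [/same_block_mul/mul_equivP uv|uv].
  have [c [d [uc cd vd]]] :
      exists c d, [/\ attached a b u c, connect (mid_step a b) c d & attached a b v d].
    (* A direct link becomes a chain: [v] is attached to some middle point, hence so is [u]. *)
    case: uv => // uv; have [c vc] := att v; exists c, c.
    by split=> //; apply: direct_attached uv vc.
  by rewrite (attL u c) // (attL v d) //; apply: connL.
apply/same_block_mul/mul_equivP; right.
have [c uc] := att u; have [d vd] := att v; exists c, d; split=> //.
by apply: conn; rewrite -(attL u c) // -(attL v d).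
Qed.

Lemma codom_perm (s : {perm X}) t : t \in codom s.
Proof. by apply/codomP; exists (s^-1 t); rewrite permKV. Qed.

Lemma perm_CSE (s : {perm X}) : perm_CS s = labelCS s id.
Proof.
apply: CS_ext => u v; rewrite same_block_label same_block_pblock.
have /and3P[_ ti _] := perm_blocks_partition s.
pose r u := match u with inl x => x | inr y => s^-1 y end.
have -> : pblock (perm_CS s) u = [set inl (r u); inr (s (r u))].
  apply: (def_pblock ti); first by apply/imsetP; exists (r u).
  by case: u => x; rewrite !inE /= ?eqxx ?permKV ?eqxx ?orbT.
rewrite !inE; case: u v => [x|x] [y|y] /=; rewrite ?permKV.
- by rewrite orbF (inj_eq perm_inj) -(inj_eq (@inl_inj X X)) eq_sym.
- by rewrite eq_sym.
- by rewrite orbF -[in RHS](permKV s x) (inj_eq perm_inj) eq_sym.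
- by rewrite eq_sym.
Qed.

Lemma mul_perm_label (T : eqType) (s : {perm X}) (f g : X -> T) :
  codom f =i codom g -> perm_CS s * labelCS f g = labelCS (f \o s) g.
Proof.
move=> fg; rewrite perm_CSE (mul_labelCS (phi := f) (psi := id)) //.
  by move=> t; rewrite codom_perm; apply/esym/codomP; exists t.
move=> c d /= cd; apply/connect1/orP; right.
by rewrite same_block_label /= cd.
Qed.

Lemma mul_label_perm (T : eqType) (s : {perm X}) (f g : X -> T) :
  codom f =i codom g -> labelCS f g * perm_CS s = labelCS f (g \o s^-1).
Proof.
move=> fg; rewrite perm_CSE (mul_labelCS (phi := id) (psi := g \o s^-1)) //.
- by move=> t; rewrite codom_perm; apply/esym/codomP; exists t.
- by move=> c /=; rewrite permK.
move=> c d /= cd; apply/connect1/orP; left.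
by rewrite same_block_label /= cd.
Qed.

(** * Folds, and [xi] as a fold *)

Definition fold (y x : X) : X -> X := fun t => if t == y then x else t.

(* Blocks {x, y, x'} and {z, y', z'} if x, y, z are distinct, and
   {x, y, x', y'} if x = z; all other blocks are {t, t'}. *)
Definition foldCS (x y z : X) : CS X := labelCS (fold y x) (fold y z).

Lemma codom_fold x y t : x != y -> (t \in codom (fold y x)) = (t != y).
Proof.
rewrite /fold => xy; apply/codomP/idP => [[c ->]|ty].
  by case: ifP => // ->.
by exists t; rewrite (negPf ty).
Qed.

Lemma codom_fold2 x y z : x != y -> z != y -> codom (fold y x) =i codom (fold y z).
Proof. by move=> xy zy t; rewrite !codom_fold. Qed.

(** The right factor joins [x] and [y] at its top, which merges the labels [g x] and [g y]; at its
    bottom [y'] joins the block of [z']. *)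
Lemma mul_label_fold (f g : X -> X) x y z :
  codom f =i codom g -> x != y -> z != y ->
  labelCS f g * foldCS x y z =
  labelCS (fold (g y) (g x) \o f) (fold (g y) (g x) \o g \o fold y z).
Proof.
move=> fg xy zy; rewrite /foldCS; set F := fold (g y) _.
rewrite (mul_labelCS (phi := F) (psi := F \o g)) //.
- exact: codom_fold2.
- by move=> c /=; rewrite /fold; case: eqP => // ->; rewrite /F /fold eqxx if_same.
set e := mid_step _ _.
have eg c d : g c = g d -> connect e c d.
  by move=> cd; apply/connect1/orP; left; rewrite same_block_label /= cd.
have exy : connect e y x.
  by apply/connect1/orP; right; rewrite same_block_label /= /fold eqxx (negPf xy).
have eyx : connect e x y.
  by apply/connect1/orP; right; rewrite same_block_label /= /fold eqxx (negPf xy).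
move=> c d; rewrite /F /fold; case: eqP => [cy|_]; case: eqP => [dy|_] E.
- by apply: eg; rewrite cy dy.
- exact: connect_trans (eg _ _ cy) (connect_trans exy (eg _ _ E)).
- exact: connect_trans (eg _ _ E) (connect_trans eyx (eg _ _ (esym dy))).
- exact: eg.
Qed.

Lemma xi_foldCS x y z (h : uniq [:: x; y; z]) :
  MkCS (xi_blocks_partition h) = foldCS x y z.
Proof.
apply: CS_ext => u v; rewrite same_block_label same_block_pblock.
have /and3P[_ ti _] := xi_blocks_partition h.
move: (h); rewrite /= !inE negb_or andbT => /andP[/andP[xy xz] yz].
pose L := label (fold y x) (fold y z).
have Ly w : L w != y.
  case: w => t; rewrite /L /= /fold; case: (eqVneq t y) => // _.
  by rewrite eq_sym.
have E : ((forall s t, (inl s == inl t :> X + X) = (s == t)) *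
          (forall s t, (inr s == inr t :> X + X) = (s == t)) *
          (forall s t, (inl s == inr t :> X + X) = false) *
          (forall s t, (inr s == inl t :> X + X) = false))%type by [].
have neq : ((x == z = false) * (z == x = false) * (y == x = false) *
            (y == z = false))%type.
  by rewrite (eq_sym z) (eq_sym y x) (negPf xy) (negPf xz) (negPf yz).
(* No point carries the label [y], so its fibre is empty and has to be set aside. *)
have fib r : [set w | L w == r] \in xi_blocks x y z \/ r = y.
  rewrite /xi_blocks !inE; case: (eqVneq r x) => [->|rx].
    left; apply/orP; left; apply/eqP/setP=> -[t|t]; rewrite !inE !E /L /= /fold;
      by case: (eqVneq t y) => [->|_]; rewrite ?neq ?eqxx ?orbT ?orbF.
  case: (eqVneq r z) => [->|rz].
    left; apply/orP; right; apply/orP; left; apply/eqP/setP=> -[t|t];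
      rewrite !inE !E /L /= /fold;
      by case: (eqVneq t y) => [->|_]; rewrite ?neq ?eqxx ?orbT ?orbF.
  case: (eqVneq r y) => [|ry]; [by right|left].
  apply/orP; right; apply/orP; right; apply/imsetP; exists r.
    by rewrite !inE !negb_or rx ry rz.
  apply/setP=> -[t|t]; rewrite !inE !E /L /= /fold ?orbF; case: (eqVneq t y) => [->|_] //;
    by rewrite !(eq_sym _ r) !(negPf rx, negPf ry, negPf rz).
have -> : pblock (MkCS (xi_blocks_partition h)) u = [set w | L w == L u].
  apply: (def_pblock ti); last by rewrite inE.
  by have [//|/eqP] := fib (L u); rewrite (negPf (Ly u)).
by rewrite inE eq_sym.
Qed.


(** * Multiplication by permutations on both sides *)

Lemma perm_triple (x y z a b c : X) :
  uniq [:: x; y; z] -> uniq [:: a; b; c] ->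
  exists r : {perm X}, [/\ r x = a, r y = b & r z = c].
Proof.
rewrite /= !inE !negb_or !andbT => /andP[/andP[xy xz] yz] /andP[/andP[ab ac] bc].
(* Each transposition puts one more point in place and fixes those already placed. *)
pose r1 := tperm x a; pose r2 := r1 * tperm (r1 y) b.
have r1x : r1 x = a by rewrite tpermL.
have r2x : r2 x = a.
  by rewrite permM r1x tpermD // 1?eq_sym // -r1x (inj_eq perm_inj).
have r2y : r2 y = b by rewrite permM tpermL.
exists (r2 * tperm (r2 z) c); split; rewrite permM ?tpermL //.
  by rewrite -r2x tpermD // ?r2x 1?eq_sym // -r2x (inj_eq perm_inj).
by rewrite -r2y tpermD // ?r2y 1?eq_sym // -r2y (inj_eq perm_inj).
Qed.

Lemma codom_comp_perm (T : eqType) (f : X -> T) (s : {perm X}) :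
  codom (f \o s) =i codom f.
Proof.
move=> t; apply/codomP/codomP => -[x ->]; first by exists (s x).
by exists (s^-1 x); rewrite /= permKV.
Qed.

Lemma mul_perm_label_perm (T : eqType) (s s' : {perm X}) (f g : X -> T) :
  codom f =i codom g ->
  perm_CS s * labelCS f g * perm_CS s' = labelCS (f \o s) (g \o s'^-1).
Proof.
move=> fg; rewrite mul_perm_label // mul_label_perm // => t.
by rewrite codom_comp_perm fg.
Qed.

(** An injective relabelling [r] that carries one triple to the other does not change the partition;
    [s * r] and [s' * r] are then absorbed on the two sides. Thus all folds on distinct triples
    share one double coset. *)
Lemma label_fold_perm (x y z a b c : X) (s s' : {perm X}) :
  uniq [:: x; y; z] -> uniq [:: a; b; c] ->
  exists p q : {perm X}, labelCS (fold y x \o s) (fold y z \o s') =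
                         perm_CS p * foldCS a b c * perm_CS q.
Proof.
move=> xyz abc; have [r [rx ry rz]] := perm_triple xyz abc.
have rE t1 t2 t : r (fold t1 t2 t) = fold (r t1) (r t2) (r t).
  by rewrite /fold (inj_eq perm_inj); case: ifP.
exists (s * r), (s' * r)^-1; rewrite mul_perm_label_perm; last first.
  move: abc; rewrite /= !inE negb_or andbT => /andP[/andP[ab _] bc].
  by apply: codom_fold2; rewrite // eq_sym.
rewrite -(labelCS_inj _ _ (@perm_inj _ r)) invgK.
by apply: eq_labelCS => t; rewrite /= rE ?rx ?ry ?rz permM.
Qed.

Lemma label_inj_perm (f g : X -> X) : injective f -> injective g ->
  exists s : {perm X}, labelCS f g = perm_CS s.
Proof.
move=> fI gI; exists (perm fI * (perm gI)^-1).
rewrite perm_CSE -(labelCS_inj f g (@perm_inj _ (perm gI)^-1)).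
by apply: eq_labelCS => t /=; [rewrite permM permE | rewrite -[g t](permE gI) permK].
Qed.

Lemma codom_full_inj (f : X -> X) : (forall t, t \in codom f) -> injective f.
Proof.
move=> ft; apply: in2T; apply/image_injP/eqP; apply: eq_card => t.
by rewrite !inE; apply: ft.
Qed.

Lemma codom_missing_ninj (f : X -> X) t : t \notin codom f ->
  exists x y, x != y /\ f x = f y.
Proof.
move=> tf; have /injectivePn[x [y xy E]] : ~~ injectiveb f; last by exists x, y.
by apply: contra tf => /injectiveP fI; apply: inj_card_onto fI (leqnn _) t.
Qed.

(** The point [p'] keeps the old value in the image, so moving [p] to [t] loses nothing. *)
Lemma codom_split (f : X -> X) p p' t : p != p' -> f p = f p' ->
  codom [eta f with p |-> t] =i t :: codom f.
Proof.
move=> pp fp t1; rewrite inE; apply/codomP/orP => [[c ->] /=|[/eqP->|/codomP[c ->]]].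
- by case: ifP => _; [left | right; apply: codom_f].
- by exists p; rewrite /= eqxx.
case: (eqVneq c p) => [->|/negPf cp]; last by exists c; rewrite /= cp.
by exists p'; rewrite /= eq_sym (negPf pp).
Qed.

Lemma exists_third (a b c x y : X) : uniq [:: a; b; c] -> exists z, (z != x) && (z != y).
Proof.
move=> abc; have /allPn[z _] : ~~ all (mem [:: x; y]) [:: a; b; c].
  by apply/negP => /allP /(uniq_leq_size abc).
by rewrite !inE negb_or; exists z.
Qed.

Lemma label_closed (S : {set CS X}) (a b c : X) :
  {in S &, forall e d, e * d \in S} -> (forall s, perm_CS s \in S) ->
  uniq [:: a; b; c] -> foldCS a b c \in S ->
  forall f g : X -> X, codom f =i codom g -> labelCS f g \in S.
Proof.
move=> Sm Sp abc Sf.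
have fold3 x y z : uniq [:: x; y; z] -> foldCS x y z \in S.
  move=> xyz; pose e : {perm X} := 1.
  have [p [q E]] := label_fold_perm e e xyz abc.
  have -> : foldCS x y z = labelCS (fold y x \o e) (fold y z \o e).
    by apply: eq_labelCS => t; rewrite /= perm1.
  by rewrite E !Sm.
have fold2 x y z : x != y -> z != y -> foldCS x y z \in S.
  move=> xy zy; case: (eqVneq z x) => [->|zx]; last first.
    by apply: fold3; rewrite /= !inE negb_or xy eq_sym zx eq_sym zy.
  have [t /andP[tx ty]] := exists_third x y abc.
  (* The left factor already joins [y'] to [t'], so joining [y] to [t] in the right factor glues
     nothing new; [x] and [y] reach [x'] and [y'] through the middle point [x]. *)
  have -> : foldCS x y x = foldCS x y t * foldCS t y x.
    rewrite mul_label_fold //; last exact: codom_fold2.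
    have [-> ->] : fold y t y = t /\ fold y t t = t by rewrite /fold eqxx if_same.
    have tt w : fold t t w = w by rewrite /fold; case: eqP => [->|].
    apply: eq_labelCS => s; rewrite /= tt // /fold.
    by case: (eqVneq s y) => [_|/negPf->//]; rewrite (negPf xy).
  apply: Sm; apply: fold3; rewrite /= !inE negb_or.
    by rewrite xy eq_sym tx eq_sym ty.
  by rewrite ty tx eq_sym xy.
move=> f g; move: {2}#|_| (leqnn #|[predC codom f]|) => m.
elim: m f g => [|m IH] f g.
  rewrite leqn0 => /pred0P full fg.
  have ff t : t \in codom f by have /negbFE := full t.
  have [s ->] := label_inj_perm (codom_full_inj ff)
    (codom_full_inj (fun t => etrans (esym (fg t)) (ff t))).
  exact: Sp.
move=> fm fg; case: (pickP [predC codom f]) => [t0 /= t0f|full]; last first.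
  by apply: IH => //; rewrite eq_card0.
have t0g : t0 \notin codom g by rewrite -fg.
have [p [p' [pp fp]]] := codom_missing_ninj t0f.
have /codomP[y1 gy1] : f p \in codom g by rewrite -fg codom_f.
(* [y2] is a member of a repeated pair other than [y1], which has to keep its label; [z] may equal
   [y1]. *)
have [y2 [z [y12 zy2 gz]]] : exists y2 z, [/\ y1 != y2, z != y2 & g y2 = g z].
  have [y [z [yz gyz]]] := codom_missing_ninj t0g.
  case: (eqVneq y1 y) => [->|y1y]; first by exists z, y.
  by exists y, z; rewrite (eq_sym z).
pose f1 := [eta f with p |-> t0]; pose g1 := [eta g with y2 |-> t0].
have f1E : codom f1 =i t0 :: codom f by apply: codom_split fp.
have fg1 : codom f1 =i codom g1.
  move=> t; rewrite f1E (codom_split _ _ gz) 1?eq_sym // !inE; congr (_ || _).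
  exact: fg.
(* Since [g1 y2 = t0] and [g1 y1 = f p], the right factor folds the new label back to [f p],
   restoring [f]; below, it sends [y2] to [z], and [g1 z = g y2]. *)
have -> : labelCS f g = labelCS f1 g1 * foldCS y1 y2 z.
  have gt t : (g t == t0) = false by apply: contraNF t0g => /eqP <-; apply: codom_f.
  have ft t : (f t == t0) = false by apply: contraNF t0f => /eqP <-; apply: codom_f.
  rewrite mul_label_fold // {1 2 3 4}/g1 /= eqxx (negPf y12) -gy1.
  apply: eq_labelCS => t; rewrite /= /fold.
    by case: (eqVneq t p) => [->|_]; rewrite ?eqxx ?ft.
  case: (eqVneq t y2) => [->|ty]; first by rewrite (negPf zy2) gt.
  by rewrite (negPf ty) gt.
apply: Sm; last exact: fold2.
apply: IH => //; rewrite -ltnS; apply: leq_trans fm; apply: proper_card.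
apply/properP; split; last by exists t0; rewrite !inE // f1E mem_head.
by apply/subsetP => t; rewrite !inE f1E inE negb_or => /andP[].
Qed.

(** * Rank, and the subsemigroup that excludes [xi] *)

Lemma IP_mul a b : a \in IP X -> b \in IP X -> a * b \in IP X.
Proof.
move=> /IP_P aI /IP_P bI; apply/IP_P.
have top x : exists y, same_block (a * b) (inl x) (inr y).
  have [_ [c xc]] := aI (inl x); have [_ [y cy]] := bI (inl c).
  by exists y; apply/same_block_mul/mul_equivP; right; exists c, c.
have bot y : exists x, same_block (a * b) (inr y) (inl x).
  have [[c yc] _] := bI (inr y); have [[x xc] _] := aI (inr c).
  exists x; apply/same_block_mul/mul_equivP; right; exists c, c.
  by split; rewrite //= same_block_sym.
by case=> x; split=> //; exists x; apply: same_block_xx.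
Qed.

(** [G] factors through [F]; the induced map [h] goes into [option T2], which avoids choosing a
    default in [T2]. *)
Lemma leq_card_codom (T1 T2 : finType) (F : X -> T1) (G : X -> T2) :
  (forall x y, F x = F y -> G x = G y) -> #|codom G| <= #|codom F|.
Proof.
move=> FG; pose h t := omap G [pick x | F x == t].
have hF x : h (F x) = Some (G x).
  by rewrite /h; case: pickP => [y /eqP/FG /= ->|/(_ x)]; rewrite ?eqxx.
rewrite -(card_image (@Some_inj _) (mem (codom G))); apply: leq_trans (leq_image_card h _).
apply/subset_leq_card/subsetP => _ /imageP[_ /codomP[x ->] ->].
by apply/imageP; exists (F x); rewrite ?codom_f.
Qed.

(** For [a] in [IP X], where every block meets [X], this is the number of blocks. *)
Definition rank a := #|codom (pblock a \o inl)|.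

Lemma rank_label (T : finType) (f g : X -> T) : rank (labelCS f g) = #|codom f|.
Proof.
apply/eqP; rewrite eqn_leq; apply/andP; split; apply: leq_card_codom => x y /eqP.
  by rewrite -(same_block_label f g (inl x) (inl y)) => /eqP.
by rewrite -/(same_block _ (inl x) (inl y)) same_block_label => /eqP.
Qed.

Lemma rank_bot a : a \in IP X -> rank a = #|codom (pblock a \o inr)|.
Proof.
move=> /IP_P aI; apply: eq_card => B; apply/codomP/codomP => -[x ->].
  by have [_ [y /eqP xy]] := aI (inl x); exists y.
by have [[y /eqP xy] _] := aI (inr x); exists y.
Qed.

Lemma rank_mul_l a b : rank (a * b) <= rank a.
Proof.
apply: leq_card_codom => x y /eqP xy; apply/eqP.
by apply/same_block_mul/mul_equivP; left.
Qed.

(** The product can only enlarge the relation of [b] on [X'], so the rank is read there, as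
    [rank_bot] allows. *)
Lemma rank_mul_r a b : a \in IP X -> b \in IP X -> rank (a * b) <= rank b.
Proof.
move=> aI bI; rewrite !rank_bot //; last exact: IP_mul.
apply: leq_card_codom => x y /eqP xy; apply/eqP.
by apply/same_block_mul/mul_equivP; left.
Qed.

(* Existence of s says that every block has as many points in X as in X'. *)
Definition uniform a := [exists s : {perm X}, forall x, same_block a (inl x) (inr (s x))].

Lemma uniform_mul a b : uniform a -> uniform b -> uniform (a * b).
Proof.
move=> /existsP[s /forallP as_] /existsP[t /forallP bt].
apply/existsP; exists (s * t); apply/forallP => x; rewrite permM.
apply/same_block_mul/mul_equivP; right; exists (s x), (s x).
by split; [apply: as_ | | apply: bt].
Qed.

(** Elements of full rank are permutations, hence uniform; so within [IP X] only the non-uniform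
    elements of rank [#|X| - 1] are left out. *)
Definition tame : {set CS X} := [set a in IP X | uniform a || ((rank a).+1 < #|X|)].

Lemma in_tame a :
  (a \in tame) = (a \in IP X) && (uniform a || ((rank a).+1 < #|X|)).
Proof. by rewrite in_set. Qed.

Lemma tame_mul : {in tame &, forall a b, a * b \in tame}.
Proof.
move=> a b; rewrite !in_tame => /andP[aI ha] /andP[bI hb]; rewrite IP_mul //=.
case/orP: ha => [ua|ra]; last first.
  by apply/orP; right; apply: leq_ltn_trans ra; rewrite ltnS rank_mul_l.
case/orP: hb => [ub|rb]; first by rewrite uniform_mul.
by apply/orP; right; apply: leq_ltn_trans rb; rewrite ltnS rank_mul_r.
Qed.

Lemma perm_IP (s : {perm X}) : perm_CS s \in IP X.
Proof.
rewrite perm_CSE; apply: labelCS_IP => t; rewrite codom_perm.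
by apply/esym/codomP; exists t.
Qed.

Lemma perm_uniform (s : {perm X}) : uniform (perm_CS s).
Proof.
apply/existsP; exists s; apply/forallP=> x.
by rewrite perm_CSE same_block_label /=.
Qed.

Lemma perm_tame (s : {perm X}) : perm_CS s \in tame.
Proof. by rewrite in_tame perm_IP perm_uniform. Qed.

Lemma foldCS_ntame x y z : uniq [:: x; y; z] -> foldCS x y z \notin tame.
Proof.
move=> xyz; have [xy xz] : x != y /\ x != z.
  by move: xyz; rewrite /= !inE negb_or => /andP[/andP[]].
rewrite in_tame negb_and negb_or; apply/orP; right; apply/andP; split.
  apply/existsP => -[s /forallP h].
  have lab t t' : same_block (foldCS x y z) (inl t) (inr t') -> fold y x t = fold y z t'.
    by rewrite same_block_label => /eqP.
  (* In [X'] only [x'] is labelled [x], while in [X] both [x] and [y] are: [s] would send both to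
     [x]. *)
  have xE t : x = fold y z t -> t = x.
    rewrite /fold; case: eqP => // _ /eqP; by rewrite (negPf xz).
  have := lab _ _ (h x); have := lab _ _ (h y).
  rewrite /fold eqxx (negPf xy) -!/(fold y z _) => /xE sy /xE sx.
  by case/eqP: xy; apply: (@perm_inj _ s); rewrite sx sy.
have -> : rank (foldCS x y z) = #|predC1 y|.
  by rewrite rank_label; apply: eq_card => t; rewrite codom_fold.
by rewrite -leqNgt cardC1 leqSpred.
Qed.

Lemma ntame_foldCS (u : CS X) (a b c : X) :
  uniq [:: a; b; c] -> u \in IP X -> u \notin tame ->
  exists p q : {perm X}, u = perm_CS p * foldCS a b c * perm_CS q.
Proof.
move=> abc uI; rewrite in_tame uI /= negb_or -leqNgt => /andP[nu ru].
have [f [g [fg uE]]] := IP_label uI; subst u; rewrite rank_label in ru.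
case: (pickP [predC codom f]) => [t0 /= t0f|full]; last first.
  have ff t : t \in codom f by have /negbFE := full t.
  have [s E] := label_inj_perm (codom_full_inj ff)
    (codom_full_inj (fun t => etrans (esym (fg t)) (ff t))).
  by rewrite E perm_uniform in nu.
have t0g : t0 \notin codom g by rewrite -fg.
have fE t : t != t0 -> t \in codom f.
  move=> tt0; apply: contraTT ru => tf.
  have c2 : 1 < #|[predC codom f]| by apply/card_gt1P; exists t, t0.
  have E : #|codom f| + #|[predC codom f]| = #|X| by apply: cardC.
  by rewrite -E; move: c2; set k := #|_|; set m := #|_|; lia.
have [p [p' [pp fp]]] := codom_missing_ninj t0f.
have [y [y' [yy gy]]] := codom_missing_ninj t0g.
have f1I : injective [eta f with p |-> t0].
  apply: codom_full_inj => t; rewrite (codom_split _ pp fp) inE.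
  by case: eqVneq => //= /fE.
have g1I : injective [eta g with y |-> t0].
  apply: codom_full_inj => t; rewrite (codom_split _ yy gy) inE.
  by case: eqVneq => //= /fE; rewrite fg.
have gt t : (g t == t0) = false by apply: contraNF t0g => /eqP <-; apply: codom_f.
have ft t : (f t == t0) = false by apply: contraNF t0f => /eqP <-; apply: codom_f.
have E : labelCS f g = labelCS (fold t0 (f p) \o perm f1I) (fold t0 (g y) \o perm g1I).
  apply: eq_labelCS => t; rewrite /= permE /= /fold.
    by case: (eqVneq t p) => [->|_]; rewrite ?eqxx ?ft.
  by case: (eqVneq t y) => [->|_]; rewrite ?eqxx ?gt.
rewrite E; apply: label_fold_perm => //.
(* If [f p = g y], both sides fold [t0] in the same way, and matching the two bijections makes the
   element uniform. *)
rewrite /= !inE negb_or ft (eq_sym t0) gt /= andbT; apply: contra nu => /eqP fpgy.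
apply/existsP; exists (perm f1I * (perm g1I)^-1); apply/forallP => t.
by rewrite E same_block_label /= permM permKV fpgy.
Qed.

End Labels.

(** * Generated subsemigroups and the theorem *)

Lemma gen_subsemigroupP (X : finType) (A : {set CS X}) a :
  reflect (forall S : {set CS X}, A \subset S ->
             {in S &, forall e d, e * d \in S} -> a \in S)
          (a \in gen_subsemigroup A).
Proof.
apply: (iffP bigcapP) => h S.
  move=> AS Sm; apply: h; rewrite AS; apply/forall_inP => e eS.
  by apply/forall_inP => d dS; apply: Sm.
case/andP=> AS /forall_inP Sm; apply: h => // e d eS dS.
by have /forall_inP := Sm e eS; apply.
Qed.

Lemma sub_gen_subsemigroup (X : finType) (A : {set CS X}) : A \subset gen_subsemigroup A.
Proof. apply/subsetP => a aA; apply/gen_subsemigroupP => S /subsetP AS _; exact: AS. Qed.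

Lemma gen_subsemigroup_mul (X : finType) (A : {set CS X}) :
  {in gen_subsemigroup A &, forall a b, a * b \in gen_subsemigroup A}.
Proof.
move=> a b /gen_subsemigroupP ha /gen_subsemigroupP hb.
by apply/gen_subsemigroupP => S AS Sm; apply: (Sm); [apply: ha | apply: hb].
Qed.

(** Both halves of the theorem reduce to this: one fold on distinct points suffices by
    [label_closed], and [IP 'I_n] is itself closed and contains the generators. *)
Lemma IP_gen (n : nat) (x y z : 'I_n) (u : CS 'I_n) :
  uniq [:: x; y; z] -> u \in IP 'I_n ->
  foldCS x y z \in gen_subsemigroup (symCS n :|: [set u]) ->
  IP 'I_n = gen_subsemigroup (symCS n :|: [set u]).
Proof.
move=> xyz uI xG; set G := gen_subsemigroup _.
have sG s : perm_CS s \in G.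
  apply: (subsetP (sub_gen_subsemigroup _)); rewrite in_setU.
  by apply/orP; left; apply: imset_f.
apply/setP => a; apply/idP/idP => [/IP_label[f [g [fg ->]]]|].
  exact: (label_closed (@gen_subsemigroup_mul _ _) sG xyz xG).
move=> /gen_subsemigroupP; apply; last exact: IP_mul.
by apply/subsetP => b /setUP[/imsetP[s _ ->]|/set1P->]; [apply: perm_IP|].
Qed.

Theorem proposition8 (n : nat) (hn : 3 <= n) :
  IP 'I_n = gen_subsemigroup (symCS n :|: [set xi123 hn]) /\
  (forall u : CS 'I_n, u \in IP 'I_n ->
     (IP 'I_n = gen_subsemigroup (symCS n :|: [set u]) <->
      u \in [set g * xi123 hn * h | g : CS 'I_n in symCS n, h : CS 'I_n in symCS n])).
Proof.
rewrite /xi123 xi_foldCS; set x := Ordinal _; set y := Ordinal _; set z := Ordinal _.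
have xyz : uniq [:: x; y; z] by [].
have xzE : codom (fold y x) =i codom (fold y z) by apply: codom_fold2.
have xiI : foldCS x y z \in IP 'I_n by apply: labelCS_IP.
have xG u : u \in gen_subsemigroup (symCS n :|: [set u]).
  by apply: (subsetP (sub_gen_subsemigroup _)); apply/setUP; right; apply/set1P.
split; first exact: (IP_gen xyz xiI (xG _)).
move=> u uI; split=> [uG|/imset2P[_ _ /imsetP[p _ ->] /imsetP[q _ ->] uE]].
  (* A tame [u] would generate only tame elements, but [xi] is not tame. *)
  have ut : u \notin tame 'I_n.
    apply/negP => ut; case/negP: (foldCS_ntame xyz); move: xiI.
    rewrite uG => /gen_subsemigroupP; apply; last exact: tame_mul.
    by apply/subsetP => b /setUP[/imsetP[s _ ->]|/set1P->]; [apply: perm_tame|].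
  have [p [q ->]] := ntame_foldCS xyz uI ut.
  by apply: imset2_f; apply: imset_f.
apply: (IP_gen xyz uI).
(* The equation for [u] is solved for [xi]; the permutations cancel inside the labellings. *)
have -> : foldCS x y z = perm_CS p^-1 * u * perm_CS q^-1.
  rewrite uE (mul_perm_label_perm _ _ xzE) mul_perm_label_perm.
    by apply: eq_labelCS => t; rewrite /= ?permKV ?invgK ?permK.
  by move=> t; rewrite !codom_comp_perm xzE.
have sG s : perm_CS s \in gen_subsemigroup (symCS n :|: [set u]).
  apply: (subsetP (sub_gen_subsemigroup _)); apply/setUP; left.
  exact: imset_f.
apply: gen_subsemigroup_mul (sG _); exact: gen_subsemigroup_mul (sG _) (xG _).
Qed.
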